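(* Let $n\ge 1$ and $s\ge 0$ be integers with $2s\le n$. Then \begin{multline*} \sum_{m=0}^{n-2s}\binom{n-s-m}{s}\binom{m+s}{m}=\\ \sum_{m=0}^{n-2s-1}\Bigl[\binom{n-s-m-1}{s}\binom{m+s}{m}+\binom{n-s-m}{s}\binom{m+s-1}{m}\Bigr]+\binom{n-s-1}{n-2s}. \end{multline*}
   Context: Conventions: $\binom{-1}{0}=1$ (this occurs only for $s=0$, $m=0$), $\binom{p}{q}=0$ for integers $q>p\ge 0$, and empty sums are $0$ (the sum on the right is empty when $n=2s$). *)

(* Defs.v *)
From mathcomp Require Export all_boot.

(* All binomials are ssrnat's 'C(p, q) on nat, so 'C(p, q) = 0 for q > p.
   When 2 * s <= n and 0 < n, every subtraction occurring in the statement is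
   exact, with one exception: m + s - 1 for m = s = 0.  There truncation gives
   'C(0, 0) = 1, the value prescribed by the convention binom(-1, 0) = 1. *)
Fact bin_minus1_0 : 'C(0 + 0 - 1, 0) = 1.
Proof. by []. Qed.

(* Main.v *)
Require Import Defs.
From mathcomp Require Import all_boot.

(** The identity is Pascal's rule summed against a weight.  For [m > 0] the
    rule splits ['C(m + s, m)] into ['C(m + s - 1, m)] and
    ['C(m - 1 + s, m - 1)], while for [m = 0] the first of these terms is
    already everything.  Shifting [m] in the part carrying the second terms
    moves the weight from [m] to [m + 1]; in the part carrying the first
    terms, the last index is split off.  With the weight
    ['C(n - s - m, s)], the split-off term has [n - s - m = s] at
    [m = n - 2 * s], so its weight is ['C(s, s) = 1] and it is exactly
    the isolated binomial on the right. *)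

(** Truncated subtraction is harmless at [m = s = 0]: there [m + s - 1] is [0]
    and ['C(0, 0) = 1], the value that makes the [m = 0] case uniform in
    [s]. *)
Lemma sum_weighted_pascal (w : nat -> nat) (s N : nat) :
  \sum_(0 <= m < N.+1) w m * 'C(m + s, m) =
  \sum_(0 <= m < N) (w m.+1 * 'C(m + s, m) + w m * 'C(m + s - 1, m))
  + w N * 'C(N + s - 1, N).
Proof.
rewrite big_split /= -addnA -(big_nat_recr N 0 (fun m => w m * _)) //=.
rewrite !(big_nat_recl N 0) //= !bin0 addnCA -big_split /=; congr (_ + _).
by apply: eq_bigr => m _; rewrite addSn subn1 /= binS mulnDr addnC.
Qed.

Theorem corollary4p4 (n s : nat) (hn : 1 <= n) (hs : 2 * s <= n) :
  \sum_(0 <= m < (n - 2 * s).+1) 'C(n - s - m, s) * 'C(m + s, m) =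
  \sum_(0 <= m < n - 2 * s)
     ('C(n - s - m - 1, s) * 'C(m + s, m) + 'C(n - s - m, s) * 'C(m + s - 1, m))
  + 'C(n - s - 1, n - 2 * s).
Proof.
rewrite (sum_weighted_pascal (fun m => 'C(n - s - m, s))).
have le_sn : s <= n by apply: leq_trans hs; rewrite leq_pmull.
have le_s_ns : s <= n - s by rewrite leq_subRL // addnn -mul2n.
have defN : n - 2 * s = n - s - s by rewrite -subnDA addnn mul2n.
congr (_ + _); last by rewrite defN subKn // binn mul1n subnK.
by apply: eq_bigr => m _; rewrite -(subnDA m) addn1.
Qed.
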